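(* Let $m,n$ be positive integers and let $\mathcal{A}$ and $\mathcal{B}$ be real symmetric $m$-th order $n$-dimensional tensors. If $\mathcal{B}$ is strictly copositive, then $$\lambda^{\max}_{\mathcal{A},\mathcal{B}}=\rho(\mathcal{A},\mathcal{B}),$$ where $\rho(\mathcal{A},\mathcal{B})=\max\left\{\dfrac{\mathcal{A}x^m}{\mathcal{B}x^m}: x\in\mathbb{R}^n_+,\ \sum_{i=1}^n x_i=1\right\}$ and $\lambda^{\max}_{\mathcal{A},\mathcal{B}}$ is the largest Pareto-eigenvalue of $(\mathcal{A},\mathcal{B})$.
   Context: A real $m$-th order $n$-dimensional tensor is an array $\mathcal{A}=(a_{i_1\cdots i_m})$ with $a_{i_1\cdots i_m}\in\mathbb{R}$ for $1\le i_1,\ldots,i_m\le n$; it is symmetric if its entries are invariant under any permutation of their indices. For $x\in\mathbb{R}^n$, $\mathcal{A}x^{m-1}\in\mathbb{R}^n$ is the vector with $(\mathcal{A}x^{m-1})_i=\sum_{i_2,\ldots,i_m=1}^n a_{ii_2\cdots i_m}x_{i_2}\cdots x_{i_m}$, and $\mathcal{A}x^m=\sum_{i_1,\ldots,i_m=1}^n a_{i_1\cdots i_m}x_{i_1}\cdots x_{i_m}$. Vector inequalities are componentwise and $\mathbb{R}^n_+=\{x\in\mathbb{R}^n:x\ge 0\}$. $\mathcal{B}$ is strictly copositive if $\mathcal{B}x^m>0$ for all $x\in\mathbb{R}^n_+\setminus\{0\}$. A Pareto-eigenvalue of $(\mathcal{A},\mathcal{B})$ is a real number $\lambda$ for which there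 exists $x\in\mathbb{R}^n_+\setminus\{0\}$ with $\lambda\mathcal{B}x^{m-1}-\mathcal{A}x^{m-1}\ge 0$ and $\langle x,\lambda\mathcal{B}x^{m-1}-\mathcal{A}x^{m-1}\rangle=0$. $\lambda^{\max}_{\mathcal{A},\mathcal{B}}$ denotes the maximum of the set of all Pareto-eigenvalues of $(\mathcal{A},\mathcal{B})$. *)

(* Defs.v *)
From mathcomp Require Import all_boot all_order all_algebra.
From mathcomp Require Import all_fingroup.
From mathcomp Require Import all_classical all_reals.
Set Implicit Arguments.
Unset Strict Implicit.
Unset Printing Implicit Defensive.
Import Order.TTheory GRing.Theory Num.Theory.
Local Open Scope ring_scope.
Local Open Scope classical_set_scope.

Definition tensor (R : realType) (m n : nat) : Type := m.-tuple 'I_n -> R.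

Definition symmetric_tensor (R : realType) (m n : nat) (A : tensor R m n) : Prop :=
  forall (s : 'S_m) (t : m.-tuple 'I_n), A [tuple tnth t (s k) | k < m] = A t.

(* A x^m *)
Definition tensor_form (R : realType) (m n : nat) (A : tensor R m n)
    (x : 'cV[R]_n) : R :=
  \sum_(t : m.-tuple 'I_n) A t * \prod_(k < m) x (tnth t k) 0.

(* A x^(m-1): the order of A is written m.+1, so that the i-th entry sums over
   the m indices following i. *)
Definition tensor_apply (R : realType) (m n : nat) (A : tensor R m.+1 n)
    (x : 'cV[R]_n) : 'cV[R]_n :=
  \col_(i < n) \sum_(t : m.-tuple 'I_n)
    A [tuple of i :: t] * \prod_(k < m) x (tnth t k) 0.

Definition nonneg_vec (R : realType) (n : nat) (x : 'cV[R]_n) : Prop :=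
  forall i : 'I_n, 0 <= x i 0.

Definition inner (R : realType) (n : nat) (x y : 'cV[R]_n) : R :=
  \sum_(i < n) x i 0 * y i 0.

Definition strictly_copositive (R : realType) (m n : nat) (B : tensor R m n) : Prop :=
  forall x : 'cV[R]_n, nonneg_vec x -> x != 0 -> 0 < tensor_form B x.

Definition pareto_eigenvalue (R : realType) (m n : nat) (A B : tensor R m.+1 n)
    (lambda : R) : Prop :=
  exists x : 'cV[R]_n,
    [/\ nonneg_vec x, x != 0,
        nonneg_vec (lambda *: tensor_apply B x - tensor_apply A x) &
        inner x (lambda *: tensor_apply B x - tensor_apply A x) = 0].

Definition pareto_spectrum (R : realType) (m n : nat) (A B : tensor R m.+1 n) : set R :=
  [set lambda | pareto_eigenvalue A B lambda].

Definition simplex_ratios (R : realType) (m n : nat) (A B : tensor R m n) : set R :=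
  [set tensor_form A x / tensor_form B x |
     x in [set x : 'cV[R]_n | nonneg_vec x /\ \sum_(i < n) x i 0 = 1]].

Definition is_max (R : realType) (E : set R) (v : R) : Prop :=
  E v /\ ubound E v.

(* [sup] is a total function, so these two denote the maxima of the sets only
   when the maxima are attained; [is_max] is what asserts it. *)
Definition lambda_max (R : realType) (m n : nat) (A B : tensor R m.+1 n) : R :=
  sup (pareto_spectrum A B).

Definition rho (R : realType) (m n : nat) (A B : tensor R m n) : R :=
  sup (simplex_ratios A B).

(* Main.v *)
(** A Pareto-eigenvalue with eigenvector [x] satisfies [l B x^m = A x^m], hence
    is a ratio over the simplex after rescaling [x]. Conversely, let [l] be the
    maximal ratio, attained at [x] by compactness, and put [C = l B - A]. Then
    [C y^m >= 0] for [y >= 0] with equality at [y = x], so the derivative of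
    [C y^m] at [x] along each [e_i] is nonnegative; since [C] is symmetric,
    this derivative is a positive multiple of [(C x^(m-1))_i]. *)
Require Import Defs.
From mathcomp Require Import all_boot all_order all_algebra.
From mathcomp Require Import all_fingroup.
From mathcomp Require Import all_classical all_reals.
From mathcomp Require Import all_analysis.
Set Implicit Arguments.
Unset Strict Implicit.
Unset Printing Implicit Defensive.
Import Order.TTheory GRing.Theory Num.Theory.
Import numFieldNormedType.Exports.
Local Open Scope ring_scope.
Local Open Scope classical_set_scope.

Lemma big_tuple_cons (V : nmodType) (I : finType) (m : nat)
    (F : m.+1.-tuple I -> V) :
  \sum_t F t = \sum_i \sum_(t : m.-tuple I) F [tuple of i :: t].
Proof.
rewrite pair_bigA /=.
rewrite (reindex (fun p : I * m.-tuple I => [tuple of p.1 :: p.2])) //=.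
exists (fun t => (thead t, [tuple of behead t])) => [[i t] _|t _] /=.
  by congr pair; apply: val_inj.
by rewrite -tuple_eta.
Qed.

Lemma coef1_prod_affine (R : comNzRingType) (m : nat) (a b : 'I_m -> R) :
  (\prod_k ((a k)%:P + b k *: 'X))`_1 =
  \sum_k b k * \prod_(l | l != k) a l.
Proof.
elim: m a b => [|m IHm] a b; first by rewrite !big_ord0 coef1.
have coef0 : (\prod_(k < m) ((a (lift ord0 k))%:P
    + b (lift ord0 k) *: 'X))`_0 = \prod_(k < m) a (lift ord0 k).
  rewrite coef0_prod; apply: eq_bigr => k _.
  by rewrite coefD coefC coefZ coefX /= mulr0 addr0.
rewrite !big_ord_recl mulrDl coefD coefCM IHm -scalerAl coefZ coefXM /= coef0.
rewrite addrC; congr (_ * _ + _).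
  by rewrite [in RHS]big_mkcond big_ord_recl /= mul1r.
rewrite mulr_sumr; apply: eq_bigr => k _.
rewrite mulrCA; congr (_ * _).
rewrite [in RHS]big_mkcond big_ord_recl /= -big_mkcond /=.
by congr (_ * _); apply: eq_bigl => l; rewrite (inj_eq lift_inj).
Qed.

(** First-order condition for a minimum at the endpoint 0. Writing [p = q * 'X], the coefficient is
    [q.[0]]; were it negative, [q], hence [p], would be negative at small positive arguments. *)
Lemma horner_ge0_coef1_ge0 (R : realFieldType) (p : {poly R}) :
  p`_0 = 0 -> (forall t, 0 <= t -> 0 <= p.[t]) -> 0 <= p`_1.
Proof.
move=> p0 pge0.
have [q pq] : exists q, p = q * 'X.
  exists (drop_poly 1 p); rewrite -[LHS](poly_take_drop 1) expr1.
  suff -> : take_poly 1 p = 0 by rewrite add0r.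
  by apply/polyP=> -[|i]; rewrite coef_take_poly coef0 ?p0.
rewrite pq coefMX /= -horner_coef0 leNgt; apply/negP => q0.
have : \forall t \near (0 : R), q.[t] < 0.
  exact: (cvgr_lt _ (@continuous_horner R q 0) _ q0).
move=> /nbhs_ballP[e /= e0 he].
have e20 : 0 < e / 2 by rewrite divr_gt0.
have := pge0 (e / 2) (ltW e20).
rewrite pq hornerMX leNgt pmulr_llt0 // he //.
by rewrite /ball /= sub0r normrN gtr0_norm // ltr_pdivrMr// ltr_pMr// ltr1n.
Qed.

Section Forms.
Variable R : realType.
Implicit Types m n : nat.

Lemma inner_tensor_apply m n (A : tensor R m.+1 n) (x : 'cV[R]_n) :
  inner x (tensor_apply A x) = tensor_form A x.
Proof.
rewrite /inner /tensor_form big_tuple_cons; apply: eq_bigr => i _.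
rewrite mxE mulr_sumr; apply: eq_bigr => t _.
rewrite big_ord_recl tnth0 mulrCA; congr (_ * (_ * _)).
by apply: eq_bigr => k _; rewrite tnthS.
Qed.

Lemma tensor_formZ m n (A : tensor R m n) (c : R) (x : 'cV[R]_n) :
  tensor_form A (c *: x) = c ^+ m * tensor_form A x.
Proof.
rewrite /tensor_form mulr_sumr; apply: eq_bigr => t _.
rewrite mulrCA; congr (_ * _).
under eq_bigr do rewrite mxE.
by rewrite big_split /= prodr_const card_ord.
Qed.

Lemma tensor_formB m n (A B : tensor R m n) (c : R) (x : 'cV[R]_n) :
  tensor_form (fun t => c * B t - A t) x =
  c * tensor_form B x - tensor_form A x.
Proof.
rewrite /tensor_form mulr_sumr -sumrB; apply: eq_bigr => t _.
by rewrite mulrBl mulrA.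
Qed.

Lemma tensor_applyB m n (A B : tensor R m.+1 n) (c : R) (x : 'cV[R]_n) :
  tensor_apply (fun t => c * B t - A t) x =
  c *: tensor_apply B x - tensor_apply A x.
Proof.
apply/colP => i; rewrite !mxE mulr_sumr -sumrB; apply: eq_bigr => t _.
by rewrite mulrBl mulrA.
Qed.

Lemma continuous_tensor_form m n (A : tensor R m n) :
  continuous (fun v : 'rV[R]_n => tensor_form A v^T).
Proof.
apply: continuous_big => [|t _ v]; first exact: add_continuous.
apply: continuousM; first exact: cst_continuous.
apply: (continuous_big (@mul_continuous R)) => k _.
under eq_fun do rewrite mxE.
exact: coord_continuous.
Qed.

(* The polynomial is the form of [C] at [x + 'X e_i]; by symmetry the [m.+1]
   positions contribute equally to its linear coefficient. *)
Lemma tensor_form_slope m n (C : tensor R m.+1 n) (x : 'cV[R]_n) (i : 'I_n) :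
  symmetric_tensor C ->
  (\sum_(t : m.+1.-tuple 'I_n) C t *: \prod_(k < m.+1)
     ((x (tnth t k) 0)%:P + (tnth t k == i)%:R *: 'X))`_1 =
  tensor_apply C x i 0 *+ m.+1.
Proof.
move=> symC; rewrite coef_sum.
under eq_bigr do rewrite coefZ coef1_prod_affine mulr_sumr.
rewrite exchange_big /= -[in RHS](card_ord m.+1) -sumr_const.
apply: eq_bigr => k _; rewrite mxE.
(* Swapping positions 0 and [k] moves the perturbed index to the head; symmetry of [C] absorbs the
   swap. *)
pose s : 'S_m.+1 := tperm ord0 k.
pose f (t : m.+1.-tuple 'I_n) := [tuple tnth t (s l) | l < m.+1].
have fK : involutive f.
  by move=> t; apply: eq_from_tnth => l; rewrite !tnth_mktuple tpermK.
(* Only tuples with head [i] survive, because of the factor [(tnth t k == i)%:R]. *)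
rewrite (reindex_inj (inv_inj fK)) big_tuple_cons /= (bigD1 i) //=.
rewrite [X in _ + X]big1 ?addr0 => [|j ji]; last first.
  rewrite big1 // => t _.
  by rewrite tnth_mktuple tpermR tnth0 (negbTE ji) mul0r mulr0.
apply: eq_bigr => t _; rewrite [f _]/f symC; congr (_ * _).
rewrite tnth_mktuple tpermR tnth0 eqxx mul1r.
(* The same swap turns the product over positions other than [k] into the product over the tail. *)
rewrite (reindex_inj (@perm_inj _ s)) /= big_mkcond big_ord_recl /=.
rewrite tpermL eqxx mul1r; apply: eq_bigr => l _.
rewrite tnth_mktuple tpermK tnthS ifT //.
by rewrite -[X in _ != X](tpermL ord0 k) (inj_eq perm_inj).
Qed.

Lemma tensor_apply_ge0 m n (C : tensor R m.+1 n) (x : 'cV[R]_n) :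
  symmetric_tensor C -> nonneg_vec x -> tensor_form C x = 0 ->
  (forall y, nonneg_vec y -> 0 <= tensor_form C y) ->
  nonneg_vec (tensor_apply C x).
Proof.
move=> symC x0 Cx0 Cge0 i.
have hornerE t : (\sum_(u : m.+1.-tuple 'I_n) C u *: \prod_(k < m.+1)
    ((x (tnth u k) 0)%:P + (tnth u k == i)%:R *: 'X)).[t] =
    tensor_form C (x + t *: delta_mx i 0).
  rewrite horner_sum; apply: eq_bigr => u _.
  rewrite hornerZ horner_prod; congr (_ * _); apply: eq_bigr => k _.
  by rewrite !mxE hornerD hornerC hornerZ hornerX andbT mulrC.
rewrite -(pmulrn_lge0 _ (ltn0Sn m)) -tensor_form_slope //.
(* The constant coefficient is [tensor_form C x], and [x + t e_i] stays in the orthant for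
   [t >= 0]. *)
apply: horner_ge0_coef1_ge0 => [|t t0].
  by rewrite -horner_coef0 hornerE scale0r addr0.
rewrite hornerE; apply: Cge0 => j; rewrite !mxE.
by rewrite addr_ge0 // mulr_ge0.
Qed.

Lemma sum_nonneg_vec_gt0 n (x : 'cV[R]_n) :
  nonneg_vec x -> x != 0 -> 0 < \sum_i x i 0.
Proof.
move=> x0 xn0; rewrite lt_neqAle sumr_ge0 // andbT eq_sym.
apply: contra xn0; rewrite psumr_eq0 // => /allP h.
apply/eqP/colP => i; rewrite mxE; apply/eqP.
by have := h i; rewrite mem_index_enum => /(_ isT).
Qed.

Lemma sum1_neq0 n (x : 'cV[R]_n) : \sum_i x i 0 = 1 -> x != 0.
Proof.
move=> x1; apply/eqP => x0; move: x1; rewrite x0.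
under eq_bigr do rewrite mxE.
by rewrite big1_eq => /eqP; rewrite eq_sym oner_eq0.
Qed.

(** The ratio is homogeneous of degree 0, so dividing [x] by its coordinate sum preserves it. *)
Lemma simplex_ratios_nonneg m n (A B : tensor R m n) (x : 'cV[R]_n) :
  nonneg_vec x -> x != 0 ->
  simplex_ratios A B (tensor_form A x / tensor_form B x).
Proof.
move=> x0 xn0; have s0 := sum_nonneg_vec_gt0 x0 xn0.
set s := \sum_i _ in s0; exists (s^-1 *: x).
  split=> [i|]; first by rewrite mxE mulr_ge0 // invr_ge0 ltW.
  under eq_bigr do rewrite mxE.
  by rewrite -mulr_sumr mulVf // gt_eqF.
by rewrite !tensor_formZ -mulf_div divff ?mul1r // expf_neq0 // invr_eq0 gt_eqF.
Qed.

Lemma pareto_spectrum_simplex_ratios m n (A B : tensor R m.+1 n) :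
  strictly_copositive B -> pareto_spectrum A B `<=` simplex_ratios A B.
Proof.
move=> copB l [x [x0 xn0 _]].
rewrite -tensor_applyB inner_tensor_apply tensor_formB => /eqP.
rewrite subr_eq0 => /eqP lE.
have -> : l = tensor_form A x / tensor_form B x.
  by rewrite -lE mulfK // gt_eqF // copB.
exact: simplex_ratios_nonneg.
Qed.

(** A closed hyperplane section of the compact cube. Row vectors are used to match [rV_compact] and
    [EVT_max_rV]. *)
Lemma compact_simplex n :
  compact [set v : 'rV[R]_n | nonneg_vec v^T /\ \sum_i v^T i 0 = 1].
Proof.
have -> : [set v : 'rV[R]_n | nonneg_vec v^T /\ \sum_i v^T i 0 = 1] =
    [set v : 'rV[R]_n | forall i, `[0, 1]%classic (v ord0 i)] `&`
    (fun v : 'rV[R]_n => \sum_i v ord0 i) @^-1` [set x | x = 1].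
  apply/seteqP; split=> v /= [v01 v1].
    have v0 i : 0 <= v ord0 i by have := v01 i; rewrite mxE.
    have vs : \sum_i v ord0 i = 1.
      by rewrite -v1; apply: eq_bigr => i _; rewrite mxE.
    split=> // i; rewrite in_itv /= v0 -vs (bigD1 i) //= lerDl.
    exact: sumr_ge0.
  split=> [i|].
    by have := v01 i; rewrite mxE in_itv /= => /andP[].
  by rewrite -[RHS]v1; apply: eq_bigr => i _; rewrite mxE.
apply: compact_closedI.
  by apply: (@rV_compact R n (fun=> `[0, 1]%classic)) => i; exact: segment_compact.
apply: (preimage_closed _ (@closed_eq _ _)) => v _.
apply: (continuous_big (@add_continuous R)) => i _.
exact: coord_continuous.
Qed.

Lemma simplex_ratios_has_max m n (A B : tensor R m n.+1) :
  strictly_copositive B -> exists v, is_max (simplex_ratios A B) v.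
Proof.
move=> copB.
pose S := [set v : 'rV[R]_n.+1 | nonneg_vec v^T /\ \sum_i v^T i 0 = 1].
pose f (v : 'rV[R]_n.+1) := tensor_form A v^T / tensor_form B v^T.
have Sn0 : S !=set0.
  (* A vertex of the simplex, which exists since the dimension is [n.+1]. *)
  exists (delta_mx 0 0); split=> [i|]; first by rewrite !mxE.
  rewrite (bigD1 0) //= !mxE /= big1 ?addr0 // => i i0.
  by rewrite !mxE (negbTE i0).
have fS : {within S, continuous f}.
  apply/continuous_in_subspaceT => v /set_mem [v0 v1].
  apply: (@continuousM _ _ (fun u : 'rV[R]_n.+1 => tensor_form A u^T)
            (fun u : 'rV[R]_n.+1 => (tensor_form B u^T)^-1)).
    exact: continuous_tensor_form.
  apply: continuousV; last exact: continuous_tensor_form.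
  by rewrite gt_eqF // copB // sum1_neq0.
have [v /set_mem Sv vmax] := EVT_max_rV Sn0 (@compact_simplex _) fS.
exists (f v); split; first by exists v^T.
move=> _ [x [x0 x1] <-].
have := vmax x^T; rewrite /f trmxK; apply.
by apply/mem_set; rewrite /S /= trmxK.
Qed.

Lemma max_simplex_ratio_pareto m n (A B : tensor R m.+1 n) (l : R) :
  symmetric_tensor A -> symmetric_tensor B -> strictly_copositive B ->
  is_max (simplex_ratios A B) l -> pareto_spectrum A B l.
Proof.
move=> symA symB copB [[x [x0 x1] lE] lmax].
have xn0 := sum1_neq0 x1.
have Cx0 : tensor_form (fun t => l * B t - A t) x = 0.
  by rewrite tensor_formB -lE divfK ?subrr // gt_eqF // copB.
exists x; split=> //; rewrite -tensor_applyB; last first.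
  by rewrite inner_tensor_apply.
apply: tensor_apply_ge0 => // [s t|y y0]; first by rewrite symA symB.
(* The ratio bound says nothing at 0, where the form vanishes because its order [m.+1] is
   positive. *)
have [->|yn0] := eqVneq y 0.
  by rewrite -(scale0r (0 : 'cV[R]_n)) tensor_formZ expr0n mul0r.
rewrite tensor_formB subr_ge0 -ler_pdivrMr ?copB //.
exact/lmax/simplex_ratios_nonneg.
Qed.

Lemma is_max_sup (E : set R) (v : R) : is_max E v -> sup E = v.
Proof.
move=> [Ev vE]; apply/eqP; rewrite eq_le ge_sup //=; last by exists v.
by apply: ub_le_sup => //; exists v.
Qed.

End Forms.

Theorem theorem3p1 (R : realType) (m n : nat) (A B : tensor R m.+1 n.+1)
    (symA : symmetric_tensor A) (symB : symmetric_tensor B)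
    (copB : strictly_copositive B) :
  [/\ is_max (pareto_spectrum A B) (lambda_max A B),
      is_max (simplex_ratios A B) (rho A B) &
      lambda_max A B = rho A B].
Proof.
have [v vmax] := simplex_ratios_has_max A copB.
(* The spectrum lies inside the set of ratios and contains its maximum, so both sets have the same
   maximum [v]. *)
have vP : is_max (pareto_spectrum A B) v.
  split; first exact: max_simplex_ratio_pareto.
  by move=> l /(pareto_spectrum_simplex_ratios copB); exact: vmax.2.
by rewrite /lambda_max /rho (is_max_sup vP) (is_max_sup vmax).
Qed.
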